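(* Let $S$ be a semisimple semiring with direct product representation \[ S \cong M_{n_1}(D_1) \times \cdots \times M_{n_r}(D_r), \] where $D_1, \dots, D_r$ are division semirings. For each $1 \le j \le r$ and $1\le i\le n_j$, let $e_{ii}^{(j)}$ denote the $n_j \times n_j$ matrix units in $M_{n_j}(D_j)$, regarded as elements of $S$. Then: (1) A right $S$-semimodule is strongly projective if and only if it is isomorphic to \[ (e_{11}^{(1)} S)^{(I_1)} \oplus \cdots \oplus (e_{11}^{(r)} S)^{(I_r)} \] for some sets $I_1, \dots, I_r$. (2) A finitely generated right $S$-semimodule is strongly projective if and only if it can be uniquely written (up to isomorphism) in the form \[ (e_{11}^{(1)} S)^{k_1} \oplus \cdots \oplus (e_{11}^{(r)} S)^{k_r}, \] where $k_1, \dots, k_r$ are nonnegative integers.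
   Context: A semiring $(S,+,\cdot,0,1)$ consists of a commutative monoid $(S,+,0)$ and a monoid $(S,\cdot,1)$ such that multiplication distributes over addition on both sides and $0s=0=s0$. It is a division semiring if $(S\setminus\{0\},\cdot,1)$ is a group. Right $S$-semimodules are commutative monoids with a unital, biadditive, associative right action of $S$ with $0_Ms=0_M=m0$. A semiring is semisimple if its regular right semimodule is a direct sum of minimal subsemimodules (minimal: nonzero with no proper nonzero subsemimodule); by the semiring Artin–Wedderburn theorem this holds if and only if $S$ is isomorphic to a finite direct product of matrix semirings $M_{n_i}(D_i)$ over division semirings $D_i$, and such an isomorphism is called a direct product representation of $S$. A right $S$-semimodule is (finitely generated) strongly projective if it is isomorphic to a direct summand of a (finitely generated) free right $S$-semimodule, where free semimodules are direct sums of copies of $S_S$. A semimodule is finitely generated if it is a homomorphic image of a free semimodule with finite basis set. An element of $M_{n_j}(D_j)$ is regarded as an element of $S$ by placing it in the $j$-th factor and $0$ in the others. $X^{(I)}$ denotes the direct sum of $I$ copies of $X$. *)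

(* Defs.v *)
From HB Require Import structures.
From mathcomp Require Import all_boot all_order all_algebra.
From mathcomp Require Import mathcomp_extra boolp classical_sets functions.
From mathcomp Require Import cardinality fsbigop.

Set Implicit Arguments.
Unset Strict Implicit.
Unset Printing Implicit Defensive.

Import GRing.Theory.

Local Open Scope classical_set_scope.
Local Open Scope ring_scope.

(* A right S-semimodule is a left semimodule over the converse semiring:
   m . s is written s *: m, and s *: (t *: m) = (t * s) *: m with t * s
   computed in S. *)
Notation rSemiModType S := (lSemiModType S^c).

(* The group (D \ {0}, *, 1): it contains 1 since D is an nzSemiRingType. *)
Definition division_semiring (D : nzSemiRingType) : Prop :=
  (forall x y : D, x != 0 -> y != 0 -> x * y != 0) /\
  (forall x : D, x != 0 -> exists2 y : D, y != 0 & x * y = 1 /\ y * x = 1).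

Section SemiringProduct.
Variables (I : Type) (R : I -> pzSemiRingType).

Definition semiring_prod : Type := forall i, R i.

HB.instance Definition _ := Choice.copy semiring_prod (forall i, R i).

Implicit Types f g : semiring_prod.

Let zero : semiring_prod := fun=> 0.
Let one : semiring_prod := fun=> 1.
Let add f g : semiring_prod := fun i => f i + g i.
Let mul f g : semiring_prod := fun i => f i * g i.

Fact semiring_prod_addA : associative add.
Proof. by move=> f g h; apply: functional_extensionality_dep => i; exact: addrA. Qed.
Fact semiring_prod_addC : commutative add.
Proof. by move=> f g; apply: functional_extensionality_dep => i; exact: addrC. Qed.
Fact semiring_prod_add0 : left_id zero add.
Proof. by move=> f; apply: functional_extensionality_dep => i; exact: add0r. Qed.
Fact semiring_prod_mulA : associative mul.
Proof. by move=> f g h; apply: functional_extensionality_dep => i; exact: mulrA. Qed.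
Fact semiring_prod_mul1l : left_id one mul.
Proof. by move=> f; apply: functional_extensionality_dep => i; exact: mul1r. Qed.
Fact semiring_prod_mul1r : right_id one mul.
Proof. by move=> f; apply: functional_extensionality_dep => i; exact: mulr1. Qed.
Fact semiring_prod_mulDl : left_distributive mul add.
Proof. by move=> f g h; apply: functional_extensionality_dep => i; exact: mulrDl. Qed.
Fact semiring_prod_mulDr : right_distributive mul add.
Proof. by move=> f g h; apply: functional_extensionality_dep => i; exact: mulrDr. Qed.
Fact semiring_prod_mul0l : left_zero zero mul.
Proof. by move=> f; apply: functional_extensionality_dep => i; exact: mul0r. Qed.
Fact semiring_prod_mul0r : right_zero zero mul.
Proof. by move=> f; apply: functional_extensionality_dep => i; exact: mulr0. Qed.

HB.instance Definition _ := GRing.isPzSemiRing.Build semiring_prod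
  semiring_prod_addA semiring_prod_addC semiring_prod_add0
  semiring_prod_mulA semiring_prod_mul1l semiring_prod_mul1r
  semiring_prod_mulDl semiring_prod_mulDr
  semiring_prod_mul0l semiring_prod_mul0r.

End SemiringProduct.

(* An element of the j-th factor, with 0 in all other factors. *)
Definition factor_inj (I : eqType) (R : I -> pzSemiRingType) (j : I) (x : R j) :
  semiring_prod R := dfwith (fun i => 0 : R i) j x.

Section DirectSum.
Variables (R : pzSemiRingType) (I : Type) (M : I -> lSemiModType R).

Definition semimod_prod : Type := forall i, M i.

HB.instance Definition _ := Choice.copy semimod_prod (forall i, M i).

Implicit Types f g : semimod_prod.

Let zero : semimod_prod := fun=> 0.
Let add f g : semimod_prod := fun i => f i + g i.
Let scale (a : R) f : semimod_prod := fun i => a *: f i.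

Fact semimod_prod_addA : associative add.
Proof. by move=> f g h; apply: functional_extensionality_dep => i; exact: addrA. Qed.
Fact semimod_prod_addC : commutative add.
Proof. by move=> f g; apply: functional_extensionality_dep => i; exact: addrC. Qed.
Fact semimod_prod_add0 : left_id zero add.
Proof. by move=> f; apply: functional_extensionality_dep => i; exact: add0r. Qed.

HB.instance Definition _ := GRing.isNmodule.Build semimod_prod
  semimod_prod_addA semimod_prod_addC semimod_prod_add0.

Fact semimod_prod_scaleA a b f : scale a (scale b f) = scale (a * b) f.
Proof. by apply: functional_extensionality_dep => i; exact: scalerA. Qed.
Fact semimod_prod_scale0 f : scale 0 f = 0.
Proof. by apply: functional_extensionality_dep => i; exact: scale0r. Qed.
Fact semimod_prod_scale1 : left_id 1 scale.
Proof. by move=> f; apply: functional_extensionality_dep => i; exact: scale1r. Qed.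
Fact semimod_prod_scaleDr : right_distributive scale +%R.
Proof. by move=> a f g; apply: functional_extensionality_dep => i; exact: scalerDr. Qed.
Fact semimod_prod_scaleDl f : {morph scale^~ f : a b / a + b}.
Proof. by move=> a b; apply: functional_extensionality_dep => i; exact: scalerDl. Qed.

HB.instance Definition _ := GRing.Nmodule_isLSemiModule.Build R semimod_prod
  semimod_prod_scaleA semimod_prod_scale0 semimod_prod_scale1
  semimod_prod_scaleDr semimod_prod_scaleDl.

Definition fin_supp : {pred semimod_prod} :=
  fun f => `[< finite_set [set i | f i != 0] >].

Fact fin_supp_closed : subsemimod_closed fin_supp.
Proof.
split; first split.
- apply/asboolP; apply: (@sub_finite_set _ _ set0) => // i /=.
  by rewrite eqxx.
- move=> f g /asboolP ff /asboolP fg; apply/asboolP.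
  apply: (@sub_finite_set _ _ ([set i | f i != 0] `|` [set i | g i != 0])).
    move=> i /=; case: (eqVneq (f i) 0) => [fi0|]; last by left.
    by rewrite -[(f + g) i]/(f i + g i) fi0 add0r; right.
  by rewrite finite_setU.
- move=> a f /asboolP ff; apply/asboolP; apply: sub_finite_set ff => i /=.
  by apply: contra_neq => fi0; rewrite -[(a *: f) i]/(a *: f i) fi0 scaler0.
Qed.

Definition dsum : Type := {f : semimod_prod | f \in fin_supp}.

HB.instance Definition _ := SubChoice.on dsum.
HB.instance Definition _ :=
  GRing.SubChoice_isSubLSemiModule.Build R semimod_prod fin_supp dsum
    fin_supp_closed.

End DirectSum.

(* Subsemimodules of M are the predicates U : submodClosed M. *)
Section Subsemimodule.
Variables (R : pzSemiRingType) (M : lSemiModType R) (U : submodClosed M).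

Definition subsemimod : Type := {x : M | x \in U}.

HB.instance Definition _ := SubChoice.on subsemimod.
HB.instance Definition _ :=
  GRing.SubChoice_isSubLSemiModule.Build R M _ subsemimod (GRing.subsemimodClosedP U).

End Subsemimodule.

Definition isomorphic (R : pzSemiRingType) (M N : lSemiModType R) : Prop :=
  exists f : {linear M -> N}, bijective f.

Definition minimal_subsemimod (R : pzSemiRingType) (M : lSemiModType R)
    (U : submodClosed M) : Prop :=
  (exists2 x, x \in U & x != 0) /\
  (forall V : submodClosed M, {subset V <= U} ->
     (forall x, x \in V -> x = 0) \/ V =i U).

Definition internal_dsum (R : pzSemiRingType) (M : lSemiModType R)
    (I : choiceType) (U : I -> submodClosed M) : Prop :=
  bijective (fun f : dsum (fun i => subsemimod (U i)) =>
    \sum_(i \in [set: I]) val (val f i)).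

Definition semisimple (S : pzSemiRingType) : Prop :=
  exists (I : choiceType) (U : I -> submodClosed ((S^c)^o)%type),
    (forall i, minimal_subsemimod (U i)) /\ internal_dsum U.

Definition free_semimod (S : pzSemiRingType) (I : Type) : rSemiModType S :=
  dsum (fun _ : I => (S^c)^o).

Definition finitely_generated (S : pzSemiRingType) (M : rSemiModType S) : Prop :=
  exists (n : nat) (f : {linear free_semimod S 'I_n -> M}),
    forall m, exists x, f x = m.

Definition direct_summand (R : pzSemiRingType) (M : lSemiModType R)
    (P : submodClosed M) : Prop :=
  exists Q : submodClosed M,
    bijective (fun pq : subsemimod P * subsemimod Q => val pq.1 + val pq.2).

Definition strongly_projective (S : pzSemiRingType) (M : rSemiModType S) : Prop :=
  exists (I : Type) (P : submodClosed (free_semimod S I)),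
    direct_summand P /\ isomorphic M (subsemimod P).

Section RightIdeal.
Variables (S : pzSemiRingType) (e : S).

Definition right_ideal_pred : {pred (S^c)^o} :=
  fun x => `[< exists s : S, (x : S) = e * s >].

Fact right_ideal_closed : subsemimod_closed right_ideal_pred.
Proof.
split; first split.
- by apply/asboolP; exists 0; rewrite mulr0.
- move=> _ _ /asboolP[s ->] /asboolP[t ->]; apply/asboolP.
  by exists (s + t); rewrite mulrDr.
- move=> a _ /asboolP[s ->]; apply/asboolP; exists (s * (a : S)).
  by rewrite mulrA.
Qed.

HB.instance Definition _ :=
  GRing.isSubSemiModClosed.Build _ _ right_ideal_pred right_ideal_closed.

Definition right_ideal : rSemiModType S := subsemimod right_ideal_pred.

End RightIdeal.

Definition sum_of_copies (S : pzSemiRingType) (r : nat) (e : 'I_r -> S)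
    (I : 'I_r -> Type) : rSemiModType S :=
  dsum (fun j : 'I_r => dsum (fun _ : I j => right_ideal (e j))).

(* Main.v *)
(* Each division semiring D is either a ring or zero-sum-free, since
   1 + x = 0 is solvable as soon as a + b = 0 for some a <> 0.  In the first case
   every D-semimodule has a basis.  In the second one, a direct sum
   decomposition of a free D-semimodule splits its basis: from d_a = x + y the
   supports of x and y lie in {a}, so x and y are multiples of d_a and one of
   them vanishes.  Either way direct summands of free D-semimodules are free,
   and the rank of a finite basis is unique.

   The statement over S follows by Morita equivalence: M is mapped to the family
   of the D_j-semimodules M e_11^(j), and a linear map is bijective if and only if
   it is bijective on all these corners.  The corner S e_11^(j) of S is free over
   D_j with basis the e_k1^(j), and the j-th corner of the sum of the
   (e_11^(i) S)^(I_i) is D_j^(I_j).  If the sum is finitely generated, I_j is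
   covered by the finite supports of the generators. *)
Require Import Defs.
From HB Require Import structures.
From mathcomp Require Import all_boot all_order all_algebra.
From mathcomp Require Import mathcomp_extra boolp classical_sets functions.
From mathcomp Require Import cardinality fsbigop.

Set Implicit Arguments.
Unset Strict Implicit.
Unset Printing Implicit Defensive.

Import GRing.Theory.
Local Open Scope classical_set_scope.
Local Open Scope ring_scope.

(** * Linear maps and direct sums *)

Lemma linear_exists (R : pzSemiRingType) (U V : lSemiModType R) (f : U -> V) :
  semilinear f -> exists g : {linear U -> V}, g =1 f.
Proof.
move=> flin.
pose L := GRing.isSemilinear.Build R U V *:%R f flin.
pose h : {linear U -> V} := HB.pack f L.
by exists h.
Qed.

Section DsumTheory.
Variables (R : pzSemiRingType) (I : Type) (M : I -> lSemiModType R).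
Implicit Types x y : dsum M.

Lemma dsum_valD x y i : val (x + y) i = val x i + val y i.
Proof. by []. Qed.

Lemma dsum_valZ a x i : val (a *: x) i = a *: val x i.
Proof. by []. Qed.

Lemma dsum_val_sum (T : Type) (s : seq T) (F : T -> dsum M) i :
  val (\sum_(t <- s) F t) i = \sum_(t <- s) val (F t) i.
Proof.
by elim: s => [|t s IHs]; rewrite ?big_nil ?big_cons ?dsum_valD ?IHs.
Qed.

Lemma dsum_eq x y : (forall i, val x i = val y i) -> x = y.
Proof. by move=> xy; apply/val_inj/functional_extensionality_dep. Qed.

(** [{classic I}] supplies decidable equality on an arbitrary index type, so that a finite support
    can be handled as a duplicate-free list. *)
Lemma dsum_supp x : exists2 s : seq {classic I},
  uniq s & forall i : {classic I}, i \notin s -> val x i = 0.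
Proof.
have /asboolP := valP x.
move=> /(@finite_seqP {classic I})[s sE].
exists (undup s) => [|i]; first exact: undup_uniq.
rewrite mem_undup; apply: contraNeq => xi0.
by have : [set` s] i by rewrite -sE.
Qed.

Lemma dsum_supp2 x y : exists s : seq {classic I}, [/\ uniq s,
  forall i : {classic I}, i \notin s -> val x i = 0 &
  forall i : {classic I}, i \notin s -> val y i = 0].
Proof.
have [s _ xs] := dsum_supp x; have [t _ yt] := dsum_supp y.
exists (undup (s ++ t)); split=> [|i|i]; rewrite ?undup_uniq //;
  rewrite mem_undup mem_cat negb_or => /andP[??]; [exact: xs|exact: yt].
Qed.

Definition prod_single (i : {classic I}) (m : M i) : semimod_prod M :=
  dfwith (fun j : {classic I} => 0 : M j) i m.

Let prod_single_in i (m : M i) : prod_single m i = m.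
Proof. exact: (@dfwith_in {classic I}). Qed.

Let prod_single_out i j (m : M i) : j <> i -> prod_single m j = 0.
Proof.
move=> ji; apply: (@dfwith_out {classic I}).
by apply/eqP => ij; apply: ji.
Qed.

Fact prod_single_fin_supp i (m : M i) : prod_single m \in fin_supp (M := M).
Proof.
apply/asboolP/(@sub_finite_set _ _ [set i : {classic I}]); last exact: finite_set1.
by move=> j /=; apply: contraPP => /prod_single_out->; rewrite eqxx.
Qed.

Lemma dsum_inj_exists i : exists g : {linear M i -> dsum M},
  forall m, val (g m) = prod_single m.
Proof.
pose f (m : M i) : dsum M := exist _ (prod_single m) (prod_single_fin_supp m).
have /linear_exists[g gE] : semilinear f; last by exists g => m; rewrite gE.
split=> [a m|m m']; apply: dsum_eq => j; rewrite ?dsum_valZ ?dsum_valD /=.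
  have [->|/prod_single_out ji] := pselect (j = i); first by rewrite !prod_single_in.
  by rewrite !ji scaler0.
have [->|/prod_single_out ji] := pselect (j = i); first by rewrite !prod_single_in.
by rewrite !ji addr0.
Qed.

Definition dsum_inj i : {linear M i -> dsum M} := sval (cid (dsum_inj_exists i)).

Lemma dsum_injE i (m : M i) : val (dsum_inj i m) i = m.
Proof. by rewrite /dsum_inj; case: cid => g /= ->; exact: prod_single_in. Qed.

Lemma dsum_inj_out i j (m : M i) : j <> i -> val (dsum_inj i m) j = 0.
Proof. by rewrite /dsum_inj; case: cid => g /= ->; exact: prod_single_out. Qed.

Lemma dsum_proj_exists i : exists g : {linear dsum M -> M i},
  forall x, g x = val x i.
Proof. exact: linear_exists. Qed.

Definition dsum_proj i : {linear dsum M -> M i} := sval (cid (dsum_proj_exists i)).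

Lemma dsum_projE i x : dsum_proj i x = val x i.
Proof. exact: (svalP (cid (dsum_proj_exists i))). Qed.

Lemma dsum_decomp x (s : seq {classic I}) : uniq s ->
  (forall i : {classic I}, i \notin s -> val x i = 0) ->
  x = \sum_(i <- s) dsum_inj i (val x i).
Proof.
move=> s_uniq xs; apply: dsum_eq => j; rewrite dsum_val_sum.
have [js|js] := boolP ((j : {classic I}) \in s).
  rewrite (bigD1_seq (j : {classic I})) // dsum_injE big1 => [|i ij].
    by rewrite Monoid.mulm1.
  by apply: dsum_inj_out => ji; rewrite ji eqxx in ij.
rewrite xs // big_seq big1 // => i si; apply: dsum_inj_out => ji.
by rewrite ji si in js.
Qed.

Lemma dsum_ind (P : dsum M -> Prop) : P 0 ->
  (forall x y, P x -> P y -> P (x + y)) ->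
  (forall i m, P (dsum_inj i m)) -> forall x, P x.
Proof.
move=> P0 PD Pi x; have [s s_uniq xs] := dsum_supp x.
rewrite (dsum_decomp s_uniq xs); elim: s {s_uniq xs} => [|i s IHs].
  by rewrite big_nil.
by rewrite big_cons; apply: PD.
Qed.

Section Lift.
Variables (N : lSemiModType R) (f : forall i, {linear M i -> N}).

Lemma dsum_lift_exists : exists g : {linear dsum M -> N},
  forall i m, g (dsum_inj i m) = f i m.
Proof.
(* The sum over the whole index set is computed by any duplicate-free list that contains the
   support. Linearity is then checked on one list that serves all the elements involved. *)
pose g x : N := \sum_(i \in [set: {classic I}]) f i (val x i).
have gE x (s : seq {classic I}) : uniq s ->
    (forall i : {classic I}, i \notin s -> val x i = 0) ->
    g x = \sum_(i <- s) f i (val x i).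
  move=> s_uniq xs; rewrite /g (fsbigE _ _ s_uniq) //=; first last.
    by move=> i _ /xs ->; rewrite linear0.
  by apply: eq_bigl => i; rewrite mem_set.
have /linear_exists[h hE] : semilinear g.
  split=> [a x|x y].
    have [s s_uniq xs] := dsum_supp x.
    rewrite (gE _ _ s_uniq xs) (gE (a *: x) _ s_uniq) => [|i /xs xi0]; last first.
      by rewrite dsum_valZ xi0 scaler0.
    by rewrite scaler_sumr; apply: eq_bigr => i _; rewrite linearZ.
  have [s [s_uniq xs ys]] := dsum_supp2 x y.
  rewrite (gE _ _ s_uniq xs) (gE _ _ s_uniq ys) (gE (x + y) _ s_uniq).
    by rewrite -big_split; apply: eq_bigr => i _; rewrite /= linearD.
  by move=> i si; rewrite dsum_valD xs // ys // addr0.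
exists h => i m; rewrite hE (gE _ [:: i : {classic I}]) //.
  by rewrite big_seq1 dsum_injE.
by move=> j; rewrite inE => /eqP; exact: dsum_inj_out.
Qed.

Definition dsum_lift : {linear dsum M -> N} := sval (cid dsum_lift_exists).

Lemma dsum_liftE i (m : M i) : dsum_lift (dsum_inj i m) = f i m.
Proof. exact: (svalP (cid dsum_lift_exists)). Qed.

End Lift.

Lemma dsum_ext (N : lSemiModType R) (f g : {linear dsum M -> N}) :
  (forall i m, f (dsum_inj i m) = g (dsum_inj i m)) -> f =1 g.
Proof.
move=> fg; elim/dsum_ind => // [|x y fgx fgy]; first by rewrite !linear0.
by rewrite !linearD fgx fgy.
Qed.

(** A tool for surjectivity: the elements whose image under [f] lies in the range of [g] are closed
    under sums, so it suffices to test the single summands. *)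
Lemma dsum_range (N X : lSemiModType R)
    (f : {linear dsum M -> N}) (g : {linear X -> N}) :
  (forall i m, exists u, g u = f (dsum_inj i m)) ->
  forall y, exists u, g u = f y.
Proof.
move=> fg; elim/dsum_ind => // [|y z [x gx] [w gw]].
  by exists 0; rewrite !linear0.
by exists (x + w); rewrite !linearD gx gw.
Qed.

End DsumTheory.

Arguments dsum_inj {R I M} i.
Arguments dsum_proj {R I M} i.

(** * Isomorphisms and direct summands *)

Section Isomorphic.
Variable R : pzSemiRingType.
Implicit Types M N P F : lSemiModType R.

Lemma linear_inv M N (f : {linear M -> N}) : bijective f ->
  exists g : {linear N -> M}, cancel f g /\ cancel g f.
Proof.
move=> [g fK gK]; have [h hE] := linear_exists (can2_semilinear fK gK).
by exists h; split=> x; rewrite hE.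
Qed.

Lemma isomorphic_sym M N : isomorphic M N -> isomorphic N M.
Proof. by move=> [f /linear_inv[g [fK gK]]]; exists g, f. Qed.

Lemma isomorphic_trans M N P :
  isomorphic M N -> isomorphic N P -> isomorphic M P.
Proof.
move=> [f fbij] [g gbij]; exists (g \o f : {linear M -> P}).
exact: bij_comp gbij fbij.
Qed.

(** Being a direct summand, expressed by maps: [i] is the inclusion, [p] the projection, and [q] the
    projection onto the complement. Without subtraction [q] cannot be obtained as 1 - ip, so it
    belongs to the data. In this form the notion passes to corners directly. *)
Definition complemented_in M F : Prop :=
  exists (i : {linear M -> F}) (p : {linear F -> M}) (q : {linear F -> F}),
    [/\ cancel i p, forall x, i (p x) + q x = x,
        forall m, q (i m) = 0 & forall x, p (q x) = 0].

Lemma complemented_in_isol M N F :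
  isomorphic M N -> complemented_in M F -> complemented_in N F.
Proof.
move=> [f /linear_inv[g [fK gK]]] [i [p [q [iK ipq qi pq]]]].
exists (i \o g : {linear N -> F}), (f \o p : {linear F -> N}), q.
split=> [n|x|n|x] /=; rewrite ?iK ?fK //.
by rewrite pq linear0.
Qed.

Lemma complemented_in_isor M F P :
  isomorphic F P -> complemented_in M F -> complemented_in M P.
Proof.
move=> [f /linear_inv[g [fK gK]]] [i [p [q [iK ipq qi pq]]]].
exists (f \o i : {linear M -> P}), (p \o g : {linear P -> M}),
  (f \o (q \o g) : {linear P -> P}).
split=> [n|x|n|x] /=; rewrite ?fK ?iK //; last by rewrite qi linear0.
by rewrite -linearD ipq gK.
Qed.

End Isomorphic.

Section LinearRange.
Variables (R : pzSemiRingType) (U V : lSemiModType R) (f : {linear U -> V}).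

Definition lin_range : {pred V} := fun x => `[< exists u, f u = x >].

Fact lin_range_closed : subsemimod_closed lin_range.
Proof.
split; first split.
- by apply/asboolP; exists 0; rewrite linear0.
- move=> _ _ /asboolP[u <-] /asboolP[v <-]; apply/asboolP.
  by exists (u + v); rewrite linearD.
- by move=> a _ /asboolP[u <-]; apply/asboolP; exists (a *: u); rewrite linearZ.
Qed.

HB.instance Definition _ :=
  GRing.isSubSemiModClosed.Build _ _ lin_range lin_range_closed.

Lemma mem_lin_range u : f u \in lin_range.
Proof. by apply/asboolP; exists u. Qed.

Definition to_lin_range (u : U) : subsemimod lin_range :=
  exist _ (f u) (mem_lin_range u).

Lemma to_lin_range_semilinear : semilinear to_lin_range.
Proof.
by split=> [a u|u v]; apply: val_inj; [exact: linearZ|exact: linearD].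
Qed.

Lemma isomorphic_lin_range : injective f -> isomorphic U (subsemimod lin_range).
Proof.
move=> f_inj; have [g gE] := linear_exists to_lin_range_semilinear.
exists g; rewrite -setTT_bijective; split=> //.
  by move=> u v _ _; rewrite !gE => /(congr1 val); exact: f_inj.
move=> [x xr] _; have /asboolP[u fu] := xr.
by exists u => //; rewrite gE; exact: val_inj.
Qed.

End LinearRange.

(** Given a decomposition, [p] and [q] come from the components of the inverse of the sum map.
    Conversely, the ranges of [i] and [q] are the two summands. *)
Lemma strongly_projectiveP (S : pzSemiRingType) (M : rSemiModType S) :
  strongly_projective M <->
  exists I : Type, complemented_in M (free_semimod S I).
Proof.
split=> [[I [P [[Q sumPQ] isoMP]]]|[I [i [p [q [iK ipq qi pq]]]]]].
  exists I; apply: complemented_in_isol (isomorphic_sym isoMP) _.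
  pose s (pq : subsemimod P * subsemimod Q) : free_semimod S I :=
    val pq.1 + val pq.2.
  have s_lin : semilinear s.
    by split=> [a x|x y]; rewrite /s /= ?linearZ ?linearD //= ?scalerDr // addrACA.
  have [h hE] := linear_exists s_lin.
  have hbij : bijective h by apply: (eq_bij sumPQ) => pq; rewrite hE.
  have [g [hK gK]] := linear_inv hbij.
  exists (val : {linear subsemimod P -> free_semimod S I}).
  exists (fst \o g : {linear free_semimod S I -> subsemimod P}).
  exists (val \o (snd \o g) : {linear free_semimod S I -> free_semimod S I}).
  have gl u : g (val u) = (u, 0).
    by rewrite -[RHS]hK hE /s /= addr0.
  have gr u : g (val u) = (0, u).
    by rewrite -[RHS]hK hE /s /= add0r.
  split=> [u|x|u|x] /=; rewrite ?gl ?gr ?linear0 //.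
  by rewrite -[RHS]gK hE.
exists I, (lin_range i : submodClosed (free_semimod S I)); split;
  last exact/isomorphic_lin_range/can_inj/iK.
(* Applying [q] to x = i(p x) + q x shows that [q] is idempotent, hence the identity on its range.
   So [p] and [q] recover the two components of a sum. *)
have qq x : q (q x) = q x by rewrite -{2}(ipq x) linearD qi add0r.
exists (lin_range q : submodClosed (free_semimod S I)); rewrite -setTT_bijective; split=> //.
  move=> [[u ur] [v vr]] [[u' ur'] [v' vr']] _ _ /= sum_eq.
  have /asboolP[m mu] := ur; have /asboolP[x xv] := vr.
  have /asboolP[m' mu'] := ur'; have /asboolP[x' xv'] := vr'.
  have uu' : u = u'.
    have := congr1 p sum_eq; rewrite -mu -mu' -xv -xv' !linearD /= !pq !iK.
    by rewrite !addr0 => ->.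
  have vv' : v = v'.
    have := congr1 q sum_eq; rewrite -mu -mu' -xv -xv' !linearD /= !qi !qq.
    by rewrite !add0r.
  by congr pair; apply: val_inj.
move=> x _; exists (to_lin_range i (p x), to_lin_range q x) => //=.
Qed.

(** * Linear combinations and free semimodules *)

Section Lincomb.
Variables (K : pzSemiRingType) (V : lSemiModType K).

Lemma scale_at_exists v : exists g : {linear K^o -> V},
  forall c : K, g c = c *: v.
Proof.
apply: linear_exists; split=> [a c|a c]; last exact: scalerDl.
by rewrite scalerA.
Qed.

Definition scale_at (v : V) : {linear K^o -> V} := sval (cid (scale_at_exists v)).

Lemma scale_atE v (c : K) : scale_at v c = c *: v.
Proof. exact: (svalP (cid (scale_at_exists v))). Qed.

Definition lincomb (I : Type) (b : I -> V) : {linear dsum (fun _ : I => K^o) -> V} :=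
  dsum_lift (fun i => scale_at (b i)).

Lemma lincombE (I : Type) (b : I -> V) i (c : K^o) :
  lincomb b (dsum_inj i c) = (c : K) *: b i.
Proof. by rewrite /lincomb dsum_liftE scale_atE. Qed.

End Lincomb.

Section Free.
Variable K : pzSemiRingType.

Definition delta (I : Type) (i : I) : dsum (fun _ : I => K^o) :=
  dsum_inj (M := fun _ => K^o) i 1.

Lemma dsum_inj_delta (I : Type) (i : I) (c : K^o) :
  dsum_inj (M := fun _ => K^o) i c = (c : K) *: delta i.
Proof. by rewrite -linearZ /= /GRing.scale /= mulr1. Qed.

Lemma free_ext (I : Type) (N : lSemiModType K)
    (f g : {linear dsum (fun _ : I => K^o) -> N}) :
  (forall i, f (delta i) = g (delta i)) -> f =1 g.
Proof. by move=> fg; apply: dsum_ext => i c; rewrite dsum_inj_delta !linearZ fg. Qed.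

Lemma lincomb_delta (V : lSemiModType K) (I : Type) (b : I -> V) i :
  lincomb b (delta i) = b i.
Proof. by rewrite lincombE scale1r. Qed.

Lemma deltaE (I : Type) (i : I) : val (delta i) i = 1.
Proof. exact: dsum_injE. Qed.

Lemma delta_out (I : Type) (i j : I) : j <> i -> val (delta i) j = 0.
Proof. exact: (dsum_inj_out (M := fun _ => K^o)). Qed.

End Free.

(** * Direct summands of free semimodules over division semirings *)

Lemma division_dichotomy (K : nzSemiRingType) : division_semiring K ->
  (exists m1 : K, 1 + m1 = 0) \/ (forall a b : K, a + b = 0 -> a = 0).
Proof.
move=> [_ Kinv].
have [h|h] := pselect (exists m1 : K, 1 + m1 = 0); [by left|right=> a b ab].
apply: contrapT => /eqP/Kinv[a' _ [_ a'a]]; apply: h; exists (a' * b).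
by rewrite -a'a -mulrDr ab mulr0.
Qed.

Section ZeroSumFree.
Variables (K : nzSemiRingType) (Kdiv : division_semiring K).
Hypothesis Kzsf : forall a b : K, a + b = 0 -> a = 0.

Lemma complemented_free_zsf (I : Type) (V : lSemiModType K) :
  complemented_in V (dsum (fun _ : I => K^o)) ->
  exists J : Type, isomorphic V (dsum (fun _ : J => K^o)).
Proof.
move=> [i [p [q [iK ipq qi pq]]]].
have p_delta a : p (delta K a) = 0 \/ i (p (delta K a)) = delta K a.
  set x := i (p (delta K a)); set y := q (delta K a).
  have xy : x + y = delta K a := ipq _.
  have summand z z' : z + z' = delta K a -> exists c : K, z = c *: delta K a.
    move=> zz'; exists (val z a); apply: dsum_eq => a'; rewrite dsum_valZ.
    have [->|a'a] := pselect (a' = a).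
      by rewrite deltaE; exact/esym/mulr1.
    have := congr1 (fun z => val z a') zz'.
    by rewrite dsum_valD delta_out // => /Kzsf ->; rewrite scaler0.
  have [c xE] := summand _ _ xy.
  have [d yE] : exists d : K, y = d *: delta K a.
    by apply: (summand y x); rewrite addrC.
  have delta_inj : injective (fun c : K => c *: delta K a).
    move=> u v /(congr1 (fun z => val z a)); rewrite !dsum_valZ deltaE.
    by move=> uv; rewrite -[LHS]mulr1 -[RHS]mulr1; exact: uv.
  have cd1 : c + d = 1.
    by apply: delta_inj; rewrite /= scalerDl -xE -yE scale1r.
  (* Compute q(x) in two ways: it is 0 because qi = 0, and it is c y = cd times the basis vector
     because x is c times that vector. Since there are no zero divisors, [c] or [d] vanishes, and c
     + d = 1 gives the other. *)
  have cd0 : c * d = 0.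
    apply: delta_inj; rewrite /= -scalerA -yE -linearZ /= -xE scale0r.
    exact: qi.
  have [c0|c0] := eqVneq c 0.
    by left; apply: (can_inj iK); rewrite linear0 -/x xE c0 scale0r.
  right; rewrite -/x.
  have [d0|/(Kdiv.1 _ _ c0)] := eqVneq d 0; last by rewrite cd0 eqxx.
  by rewrite xE -[c]addr0 -d0 cd1 scale1r.
(* The basis of [V] consists of the images of those standard basis vectors that ip fixes; [p] kills
   all the others. *)
pose J := {a : I | i (p (delta K a)) = delta K a}.
pose b (j : J) := p (delta K (sval j)).
exists J; apply: isomorphic_sym; exists (lincomb b).
rewrite -setTT_bijective; split=> //.
  (* [i] sends each [b j] back to a standard basis vector, so the coordinates of a combination can
     be read off inside the ambient free semimodule. *)
  have coord x (j : J) : val (i (lincomb b x)) (sval j) = val x j.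
    rewrite -!dsum_projE.
    apply: (@free_ext K J K^o (dsum_proj (sval j) \o (i \o lincomb b))
             (dsum_proj j)) => j' /=.
    rewrite lincomb_delta (svalP j') !dsum_projE.
    have [->|jj'] := pselect (j = j'); first by rewrite !deltaE.
    rewrite !delta_out //.
    by move: j j' jj' => [a ha] [a' ha'] /= jj' aa'; apply/jj'/eq_exist.
  move=> x y _ _ xy; apply: dsum_eq => j.
  by rewrite -!coord xy.
move=> v _; have : exists x, lincomb b x = p (i v).
  apply: dsum_range => a c; rewrite dsum_inj_delta linearZ /=.
  have [->|ipa] := p_delta a; first by exists 0; rewrite linear0 scaler0.
  exists (c *: delta K (exist _ a ipa : J)); by rewrite linearZ /= lincomb_delta.
by rewrite iK => -[x xv]; exists x.
Qed.

End ZeroSumFree.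

Section VectorSpaceBasis.
Variables (K : nzSemiRingType) (Kdiv : division_semiring K).
Variables (m1 : K) (m1E : 1 + m1 = 0) (V : lSemiModType K).

Let addm1 (W : lSemiModType K) (v : W) : v + m1 *: v = 0.
Proof. by rewrite -{1}[v]scale1r -scalerDl m1E scale0r. Qed.

Let addm1_eq (W : lSemiModType K) (v w : W) : v + m1 *: w = 0 -> v = w.
Proof.
by move=> vw; rewrite -[RHS]add0r -vw -addrA [_ + w]addrC addm1 addr0.
Qed.

Definition independent (A : set V) : Prop := forall (s : seq V) (c : V -> K),
  uniq s -> (forall v, v \in s -> A v) -> \sum_(v <- s) c v *: v = 0 ->
  forall v, v \in s -> c v = 0.

Lemma maximal_independent : exists A,
  independent A /\ forall B, A `<` B -> ~ independent B.
Proof.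
apply: Zorn_bigcup => F Find Ftot s c s_uniq sF sum0.
(* The chain may be empty, so the empty list is treated apart. A nonempty finite list in the union
   of a chain lies in one of its members. *)
have [s0|s_neq0] := eqVneq s [::]; first by rewrite s0.
suff [A FA sA] : exists2 A, F A & forall v, v \in s -> A v.
  exact: (Find A FA).
elim: s {s_uniq sum0} s_neq0 sF => [//|v s IHs] _ sF.
have [A FA Av] := sF v (mem_head v s).
have [s0|s_neq0] := eqVneq s [::].
  by exists A => // w; rewrite s0 inE => /eqP->.
have [w ws|B FB sB] := IHs s_neq0; first by apply: sF; rewrite inE ws orbT.
have [AB|BA] := Ftot _ _ FA FB; [exists B => //|exists A => //] => w;
  rewrite inE => /orP[/eqP->|]//; first exact: AB.
  exact: sB.
by move=> /sB; exact: BA.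
Qed.

Lemma division_ring_free : exists J : Type, isomorphic V (dsum (fun _ : J => K^o)).
Proof.
have [A [Aind Amax]] := maximal_independent.
pose J := {v | A v}.
exists J; apply: isomorphic_sym; exists (lincomb (sval : J -> V)).
rewrite -setTT_bijective; split=> //.
  move=> x y _ _ xy; apply: addm1_eq.
  (* [m1] acts as -1, so [z] is the difference of [x] and [y], and injectivity reduces to a trivial
     kernel. *)
  set z := x + m1 *: y.
  have z0 : lincomb (sval : J -> V) z = 0 by rewrite linearD linearZ /= xy addm1.
  have [s s_uniq zs] := dsum_supp z.
  (* Independence takes coefficients defined on all of [V], so those of [z] are extended by 0
     outside [A]. *)
  pose c v : K := if pselect (A v) is left Av then val z (exist _ v Av) else 0.
  have cE (j : {classic J}) : c (sval j) = val z j.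
    rewrite /c; case: pselect => [Av|]; last by case: j.
    by congr (val z _); case: j Av => w Aw Av; exact: eq_exist.
  have sval_inj : injective (sval : {classic J} -> V).
    by move=> [u Au] [w Aw] /= uw; exact: eq_exist.
  have sum0 : \sum_(v <- [seq sval j | j <- s]) c v *: v = 0.
    rewrite big_map -[RHS]z0 [in RHS](dsum_decomp s_uniq zs) linear_sum.
    by apply: eq_bigr => j _; rewrite lincombE cE.
  apply: dsum_eq => j.
  have [js|/zs//] := boolP ((j : {classic J}) \in s).
  rewrite -cE; apply: (Aind _ _ _ _ sum0); last exact: (@map_f {classic J}).
    by rewrite (@map_inj_uniq {classic J}).
  by move=> _ /(@mapP {classic J})[k _ ->]; case: k.
move=> v _; suff /asboolP[x xv] : v \in lin_range (lincomb (sval : J -> V)) by exists x.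
have rangeA w : A w -> w \in lin_range (lincomb (sval : J -> V)).
  move=> Aw; apply/asboolP; exists (delta K (exist _ w Aw : J)).
  exact: lincomb_delta.
apply: contrapT => vr.
have nAv : ~ A v by move=> /rangeA.
apply: (Amax (A `|` [set v])).
  by split=> [w Aw|/(_ v (or_intror erefl))]; [left|].
move=> s c s_uniq sA sum0 w ws; apply: contrapT => /eqP cw0.
have sA' u : u \in s -> u != v -> A u.
  by move=> us uv; have [//|/= uv'] := sA u us; rewrite uv' eqxx in uv.
(* The coefficient of [v] counts as 0 when [v] is absent from [s]. If it is 0, the relation involves
   only [A] and is trivial; otherwise it can be solved for [v], which puts [v] in the span of
   [A]. *)
have [cv0|cv0] := eqVneq (if v \in s then c v else 0) 0.
  have sum0' : \sum_(u <- [seq u <- s | u != v]) c u *: u = 0.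
    rewrite big_filter -[RHS]sum0 [RHS](bigID (fun u => u != v)) /=.
    rewrite -[LHS]addr0; congr (_ + _); apply/esym.
    rewrite big_seq_cond big1 // => u /andP[us /negPn/eqP uv].
    by move: us cv0; rewrite uv => -> ->; rewrite scale0r.
  have wv : w != v.
    by apply: contra_neq cw0 => wv; rewrite wv in ws *; rewrite ws in cv0.
  move/eqP: cw0; apply; apply: (Aind _ _ (filter_uniq _ s_uniq) _ sum0').
    by move=> u; rewrite mem_filter => /andP[uv us]; exact: sA'.
  by rewrite mem_filter wv ws.
have vs : v \in s by apply: contraNT cv0 => /negPf ->.
rewrite vs in cv0.
have [d _ [_ dc]] := Kdiv.2 _ cv0.
apply: vr.
have := sum0; rewrite (bigD1_seq v) //=.
set t := \sum_(_ <- _ | _) _ => cvt.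
(* From c(v) v + t = 0 follows -t = c(v) v, and [d] is a left inverse of c(v). *)
have -> : v = (d * m1) *: t.
  rewrite -scalerA.
  have -> : m1 *: t = c v *: v.
    by rewrite -[RHS]addr0 -(addm1 t) addrA cvt add0r.
  by rewrite scalerA dc scale1r.
apply: rpredZ; rewrite /t big_seq_cond; apply: rpred_sum => u /andP[us uv].
by apply: rpredZ; apply: rangeA; exact: sA'.
Qed.

End VectorSpaceBasis.

Lemma complemented_free (K : nzSemiRingType) (I : Type) (V : lSemiModType K) :
  division_semiring K -> complemented_in V (dsum (fun _ : I => K^o)) ->
  exists J : Type, isomorphic V (dsum (fun _ : J => K^o)).
Proof.
move=> Kdiv VF; have [[m1 m1E]|Kzsf] := division_dichotomy Kdiv.
  exact: (division_ring_free Kdiv m1E V).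
exact: (complemented_free_zsf Kdiv Kzsf VF).
Qed.

(** * Matrix inequalities behind the uniqueness of rank *)

Lemma left_inverse_leq_ring (K : nzSemiRingType) (m1 : K) (k l : nat)
    (A : 'M[K]_(k, l)) (B : 'M[K]_(l, k)) :
  division_semiring K -> 1 + m1 = 0 -> A *m B = 1%:M -> (k <= l)%N.
Proof.
move=> Kdiv m1E; elim: k l A B => [//|k IHk] l A B AB.
have ABE i i' : \sum_j A i j * B j i' = (i == i')%:R.
  by have := congr1 (fun C : 'M_k.+1 => C i i') AB; rewrite !mxE.
have [j Aj0] : exists j, A 0 j != 0.
  apply: contrapT => A0; have /eqP := ABE 0 0; rewrite eqxx big1.
    by rewrite eq_sym oner_eq0.
  move=> j _; have [->|Aj0] := eqVneq (A 0 j) 0; first exact: mul0r.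
  by case: A0; exists j.
case: l A B AB ABE j Aj0 => [|l] A B _ ABE j Aj0; first by case: j Aj0.
have [d _ [_ dA]] := Kdiv.2 _ Aj0.
(* Gaussian elimination with pivot [A 0 j]: adding [u i] times row 0 to row [lift 0 i] clears its
   entry in column [j]. Row 0 of the product is 0 off the diagonal, so after deleting row 0 and
   column [j] of [A], and row [j] and column 0 of [B], the product is still an identity matrix. *)
pose u i : K := m1 * A (lift 0 i) j * d.
apply: (IHk l (\matrix_(i, j') (A (lift 0 i) (lift j j') + u i * A 0 (lift j j')))
  (\matrix_(j', i) B (lift j j') (lift 0 i))).
apply/matrixP => i i'.
have := congr2 (fun a b => a + u i * b) (ABE (lift 0 i) (lift 0 i'))
  (ABE 0 (lift 0 i')).
rewrite !mxE (inj_eq lift_inj) mulr0 addr0 => <-.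
rewrite mulr_sumr -big_split /= (bigD1_ord j) //=.
rewrite mulrA -mulrDl -[_ * d * _]mulrA dA mulr1.
rewrite -[X in (X + m1 * _)]mul1r -mulrDl m1E !mul0r add0r.
by apply: eq_bigr => j' _; rewrite !mxE mulrDl mulrA.
Qed.

Lemma left_inverse_leq (K : nzSemiRingType) (k l : nat)
    (A : 'M[K]_(k, l)) (B : 'M[K]_(l, k)) :
  division_semiring K -> A *m B = 1%:M -> (k <= l)%N.
Proof.
move=> Kdiv AB.
have ABE i i' : \sum_j A i j * B j i' = (i == i')%:R.
  by have := congr1 (fun C : 'M_k => C i i') AB; rewrite !mxE.
have [[m1 m1E]|Kzsf] := division_dichotomy Kdiv.
  exact: (left_inverse_leq_ring Kdiv m1E AB).
have Ksum0 (T : finType) (F : T -> K) : \sum_s F s = 0 -> forall t, F t = 0.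
  move=> sum0 t; move: sum0; by rewrite (bigD1 t) //= => /Kzsf.
(* Each diagonal entry 1 has a nonzero term, at a column f(i). If f(i) = f(i') with i and i'
   distinct, the term of that column in the off-diagonal entry (i, i') is a product of nonzero
   factors, yet it vanishes by zero-sum-freeness. So f is injective. *)
have exf i : exists j, A i j * B j i != 0.
  apply: contrapT => AB0; have /eqP := ABE i i; rewrite eqxx big1.
    by rewrite eq_sym oner_eq0.
  move=> j _; have [//|ABj] := eqVneq (A i j * B j i) 0.
  by case: AB0; exists j.
have [f fE] := choice exf.
have f_inj : injective f.
  move=> i i' ff'; apply: contrapT => /eqP ii'.
  have := ABE i i'; rewrite (negPf ii') => /Ksum0 /(_ (f i)).
  apply/eqP/Kdiv.1.
    by apply: contra_neq (fE i) => ->; rewrite mul0r.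
  by rewrite ff'; apply: contra_neq (fE i') => ->; rewrite mulr0.
by have := leq_card f f_inj; rewrite !card_ord.
Qed.

(** * Corners of a semimodule *)

(* Not required to be unital: iota 1 is an idempotent of R, and the corner of M
   is iota 1 *: M, on which K acts through iota. *)
Record corner_embedding (K R : pzSemiRingType) := CornerEmbedding {
  corner_embedding_fun :> K -> R;
  corner_embedding0 : corner_embedding_fun 0 = 0;
  corner_embeddingD : {morph corner_embedding_fun : x y / x + y};
  corner_embeddingM : {morph corner_embedding_fun : x y / x * y} }.

Section Corner.
Variables (K R : pzSemiRingType) (iota : corner_embedding K R).

Section CornerModule.
Variable M : lSemiModType R.

Definition corner_pred : {pred M} := fun m => iota 1 *: m == m.

Fact corner_closed : Algebra.addumagma_closed corner_pred.
Proof.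
split=> [|x y /eqP xE /eqP yE]; apply/eqP; first exact: scaler0.
by rewrite scalerDr xE yE.
Qed.

Definition corner : Type := {m : M | m \in corner_pred}.

HB.instance Definition _ := SubChoice.on corner.
HB.instance Definition _ :=
  GRing.SubChoice_isSubNmodule.Build M corner_pred corner corner_closed.

Lemma cornerP (m : corner) : iota 1 *: val m = val m.
Proof. by apply/eqP; exact: (valP m). Qed.

Fact corner_scale_subproof (c : K) (m : corner) : iota c *: val m \in corner_pred.
Proof. by apply/eqP; rewrite scalerA -corner_embeddingM mul1r. Qed.

Definition corner_scale c m : corner := exist _ (iota c *: val m) (corner_scale_subproof c m).

Fact corner_scaleA a b m : corner_scale a (corner_scale b m) = corner_scale (a * b) m.
Proof. by apply: val_inj; rewrite /= scalerA corner_embeddingM. Qed.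
Fact corner_scale0 m : corner_scale 0 m = 0.
Proof. by apply: val_inj; rewrite /= corner_embedding0 scale0r. Qed.
Fact corner_scale1 : left_id 1 corner_scale.
Proof. by move=> m; apply: val_inj; exact: cornerP. Qed.
Fact corner_scaleDr : right_distributive corner_scale +%R.
Proof. by move=> a m m'; apply: val_inj; exact: scalerDr. Qed.
Fact corner_scaleDl m : {morph corner_scale^~ m : a b / a + b}.
Proof. by move=> a b; apply: val_inj; rewrite /= corner_embeddingD scalerDl. Qed.

HB.instance Definition _ := GRing.Nmodule_isLSemiModule.Build K corner
  corner_scaleA corner_scale0 corner_scale1 corner_scaleDr corner_scaleDl.

Lemma corner_valZ (c : K) (m : corner) : val (c *: m) = iota c *: val m.
Proof. by []. Qed.

Lemma corner_valD (m m' : corner) : val (m + m') = val m + val m'.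
Proof. by []. Qed.

End CornerModule.

Section CornerMap.
Variables (M N : lSemiModType R) (f : {linear M -> N}).

Fact corner_map_subproof (m : corner M) : f (val m) \in corner_pred (M := N).
Proof. by apply/eqP; rewrite -linearZ /= cornerP. Qed.

Definition corner_map (m : corner M) : corner N :=
  exist _ (f (val m)) (corner_map_subproof m).

Lemma corner_map_semilinear : semilinear corner_map.
Proof.
by split=> [a m|m m']; apply: val_inj; [exact: linearZ|exact: linearD].
Qed.

HB.instance Definition _ := GRing.isSemilinear.Build K (corner M) (corner N)
  *:%R corner_map corner_map_semilinear.

End CornerMap.

Lemma corner_isomorphic (M N : lSemiModType R) :
  isomorphic M N -> isomorphic (corner M) (corner N).
Proof.
move=> [f /linear_inv[g [fK gK]]]; exists (corner_map f).
by exists (corner_map g) => m; apply: val_inj; rewrite /= ?fK ?gK.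
Qed.

Lemma corner_complemented (M F : lSemiModType R) :
  complemented_in M F -> complemented_in (corner M) (corner F).
Proof.
move=> [i [p [q [iK ipq qi pq]]]].
exists (corner_map i), (corner_map p), (corner_map q).
by split=> x; apply: val_inj; rewrite /= ?iK ?ipq ?qi ?pq.
Qed.

(** The map [coord a] sends a combination with coefficients c to [iota] of c(a), which gives
    injectivity. Spanning is asked for [iota 1 *: m] with [m] in all of [M], so that it can be
    proved by induction on [m]; elements of the corner are fixed by [iota 1]. *)
Lemma corner_basis_bij (M : lSemiModType R) (J : Type) (b : J -> corner M)
    (coord : J -> {linear M -> R^o}) :
  injective iota ->
  (forall a, coord a (val (b a)) = iota 1) ->
  (forall a a', a <> a' -> coord a (val (b a')) = 0) ->
  (forall m, exists c, val (lincomb b c) = iota 1 *: m) ->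
  bijective (lincomb b).
Proof.
move=> iota_inj coord1 coord0 spanb; rewrite -setTT_bijective; split=> //.
  move=> x y _ _ xy; apply: dsum_eq => a; apply: iota_inj.
  have e_corner : (iota 1 : R^o) \in corner_pred (M := R^o).
    by apply/eqP; rewrite /GRing.scale /= -corner_embeddingM mulr1.
  pose e : corner R^o := exist _ (iota 1 : R^o) e_corner.
  have coordE c : val (corner_map (coord a) (lincomb b c)) = iota (val c a) :> R.
    have -> : corner_map (coord a) (lincomb b c) = (val c a : K) *: e.
      rewrite -dsum_projE -scale_atE.
      apply: (@free_ext K J (corner R^o) (corner_map (coord a) \o lincomb b)
         (scale_at e \o dsum_proj a)) => a' /=.
      rewrite lincomb_delta dsum_projE scale_atE.
      have [->|aa'] := pselect (a = a').
        by rewrite deltaE scale1r; apply: val_inj; rewrite /= coord1.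
      rewrite delta_out // scale0r; apply: val_inj.
      by rewrite /= coord0.
    by rewrite corner_valZ /GRing.scale /= -corner_embeddingM mulr1.
  by rewrite -!coordE xy.
move=> m _; have [c cE] := spanb (val m); exists c => //.
by apply: val_inj; rewrite cE cornerP.
Qed.

End Corner.

Arguments corner_pred {K R} iota {M}.
Arguments corner_map {K R} iota {M N} f.

(** * Rank of free semimodules and reindexing of copies *)

Lemma isomorphic_free_leq (K : nzSemiRingType) (k l : nat) : division_semiring K ->
  isomorphic (dsum (fun _ : 'I_k => K^o)) (dsum (fun _ : 'I_l => K^o)) ->
  (k <= l)%N.
Proof.
move=> Kdiv [f /linear_inv[g [fK _]]].
(* Scalars act on the left, so the images of basis vectors are written as rows, and [f] followed by
   [g] has matrix [A *m B]. *)
pose A : 'M[K]_(k, l) := \matrix_(i, j) val (f (delta K i)) j.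
pose B : 'M[K]_(l, k) := \matrix_(i, j) val (g (delta K i)) j.
apply: (@left_inverse_leq K k l A B Kdiv); apply/matrixP => i i'.
have decomp (x : dsum (fun _ : 'I_l => K^o)) :
    x = \sum_j (val x j : K) *: delta K j.
  apply: dsum_eq => j; rewrite dsum_val_sum (bigD1 j) // big1 => [|j' jj'].
    by rewrite Monoid.mulm1 dsum_valZ deltaE; exact/esym/mulr1.
  by rewrite dsum_valZ delta_out ?scaler0 // => /esym/eqP; rewrite (negPf jj').
have := congr1 (fun x => val x i') (fK (delta K i)).
rewrite [f _]decomp linear_sum dsum_val_sum !mxE => fgE.
transitivity (val (delta K i) i' : K); last first.
  have [<-|ii'] := eqVneq i i'; first exact: deltaE.
  by apply: delta_out => /esym/eqP; rewrite (negPf ii').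
rewrite -fgE; apply: eq_bigr => j _; rewrite !mxE linearZ dsum_valZ.
by [].
Qed.

Lemma finite_set_bij_ord (T : Type) : finite_set [set: T] ->
  exists (k : nat) (s : T -> 'I_k) (t : 'I_k -> T), cancel s t /\ cancel t s.
Proof.
move=> /(@finite_seqP {classic T})[s0 s0T].
pose s := undup s0; have sT (x : {classic T}) : x \in s.
  by rewrite mem_undup; have : [set: T] x by []; rewrite s0T.
have ltx (x : {classic T}) : (index x s < size s)%N by rewrite index_mem.
exists (size s), (fun x : T => Ordinal (ltx x)), (tnth (in_tuple s)); split=> [x|i].
  by rewrite (tnth_nth (x : {classic T})) /= nth_index.
by apply: val_inj; rewrite /= (tnth_nth (tnth (in_tuple s) i)) index_uniq ?undup_uniq.
Qed.

Lemma sum_of_copies_reindex (S : pzSemiRingType) (r : nat) (e : 'I_r -> S)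
    (I J : 'I_r -> Type) (s : forall j, I j -> J j) (t : forall j, J j -> I j) :
  (forall j, cancel (s j) (t j)) -> (forall j, cancel (t j) (s j)) ->
  isomorphic (sum_of_copies e I) (sum_of_copies e J).
Proof.
move=> sK tK.
pose copies (A : 'I_r -> Type) j : rSemiModType S := dsum (fun _ : A j => right_ideal (e j)).
pose map_copies (A B : 'I_r -> Type) (h : forall j, A j -> B j) :
    {linear sum_of_copies e A -> sum_of_copies e B} :=
  dsum_lift (fun j => dsum_inj j \o dsum_lift (fun a =>
      dsum_inj (M := fun _ : B j => right_ideal (e j)) (h j a)) :
    {linear copies A j -> sum_of_copies e B}).
have map_copiesE A B h j a m :
  @map_copies A B h (dsum_inj j (dsum_inj a m)) = dsum_inj j (dsum_inj (@h j a) m).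
  by rewrite /map_copies dsum_liftE /= dsum_liftE.
have map_copiesK A B h h' : (forall j, cancel (@h j) (@h' j)) ->
    cancel (@map_copies A B h) (@map_copies B A h').
  move=> hK; apply: (@dsum_ext _ _ _ _ (@map_copies B A h' \o @map_copies A B h) idfun).
  move=> j x.
  apply: (@dsum_ext _ _ _ _ ((@map_copies B A h' \o @map_copies A B h) \o dsum_inj j)
    (dsum_inj j)) => a m /=.
  by rewrite !map_copiesE hK.
by exists (map_copies _ _ s), (map_copies _ _ t); exact: map_copiesK.
Qed.

(** * Morita equivalence through the corners *)

Section Frame.
(* In the intended instance iota j d = d e_11^(j), u k = e_1k^(j) and
   v k = e_k1^(j); products in S^c are those of S reversed, so that v k * u k'
   below is e_1k' e_k1 in S. *)
Variables (S : pzSemiRingType) (r : nat) (K : 'I_r -> nzSemiRingType).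
Variables (iota : forall j, corner_embedding (K j) S^c) (e : 'I_r -> S).
Variables (n : 'I_r -> nat) (u v : forall j, 'I_(n j) -> S^c).
Hypothesis iota_inj : forall j, injective (iota j).
Hypothesis iota_surj : forall j (x : S^c), exists c,
  iota j c = iota j 1 * x * iota j 1.
Hypothesis iota_orth : forall j j', j != j' -> forall x : S^c,
  iota j 1 * x * iota j' 1 = 0.
Hypothesis eE : forall j, e j = iota j 1.
Hypothesis vE : forall j (k : 'I_(n j)), iota j 1 * v k = v k :> S^c.
Hypothesis uE : forall j (k : 'I_(n j)), u k * iota j 1 = u k.
Hypothesis vu : forall j (k k' : 'I_(n j)), v k * u k' = if k == k' then iota j 1 else 0.
Hypothesis uv1 : \sum_j \sum_(k < n j) u k * v k = 1.

(** The identity 1 = sum of u_k v_k writes every x as a combination of the elements v_k x, which lie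
    in the corners. Injectivity and surjectivity can both be tested on these. *)
Lemma corner_map_bij (M N : rSemiModType S) (g : {linear M -> N}) :
  (forall j, bijective (corner_map (iota j) g)) -> bijective g.
Proof.
move=> gbij.
have frame (W : rSemiModType S) (x : W) : x = \sum_j \sum_(k < n j) u k *: (v k *: x).
  rewrite -{1}[x]scale1r -uv1 scaler_suml; apply: eq_bigr => j _.
  by rewrite scaler_suml; apply: eq_bigr => k _; rewrite scalerA.
have v_corner (W : rSemiModType S) (x : W) j (k : 'I_(n j)) :
    v k *: x \in corner_pred (iota j) (M := W).
  by apply/eqP; rewrite scalerA vE.
rewrite -setTT_bijective; split=> //.
  move=> x y _ _ gxy; rewrite [x]frame [y]frame.
  apply: eq_bigr => j _; apply: eq_bigr => k _; congr (_ *: _).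
  have /(bij_inj (gbij j))/(congr1 val)// :
    corner_map (iota j) g (exist _ (v k *: x) (v_corner _ x j k)) =
    corner_map (iota j) g (exist _ (v k *: y) (v_corner _ y j k)).
  by apply: val_inj; rewrite /= !linearZ /= gxy.
move=> y _; suff /asboolP[x xy] : y \in lin_range g by exists x.
rewrite [y]frame; apply: rpred_sum => j _; apply: rpred_sum => k _.
apply: rpredZ; have [h _ hK] := gbij j; apply/asboolP.
exists (val (h (exist _ (v k *: y) (v_corner _ y j k)))).
by have /(congr1 val) := hK (exist _ (v k *: y) (v_corner _ y j k)).
Qed.

Lemma iota_idem j : iota j 1 * iota j 1 = iota j 1.
Proof. by rewrite -corner_embeddingM mulr1. Qed.

(** Read in [S^c], the right ideal of [e j] is the left ideal generated by the idempotent
    [iota j 1], hence fixed by multiplying by it on the right. *)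
Lemma right_idealP j (x : right_ideal (e j)) : (val x : S^c) * iota j 1 = val x.
Proof.
have /asboolP[s sE] := valP x.
have xE : (val x : S^c) = (s : S^c) * iota j 1 by rewrite sE eE.
by rewrite xE -mulrA iota_idem.
Qed.

Lemma right_ideal_valZ j (a : S^c) (x : right_ideal (e j)) :
  val (a *: x) = a * (val x : S^c).
Proof. by rewrite linearZ. Qed.

Fact right_ideal_gen_subproof j : (e j : S^c) \in right_ideal_pred (e j).
Proof. by apply/asboolP; exists 1; rewrite mulr1. Qed.

Definition right_ideal_gen j : right_ideal (e j) :=
  exist _ (e j : S^c) (right_ideal_gen_subproof j).

Lemma right_ideal_gen_val j : val (right_ideal_gen j) = iota j 1.
Proof. exact: eE. Qed.

Lemma right_ideal_genE j : iota j 1 *: right_ideal_gen j = right_ideal_gen j.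
Proof. by apply: val_inj; rewrite right_ideal_valZ right_ideal_gen_val iota_idem. Qed.

Section Copies.
Variable I : 'I_r -> Type.
Local Notation X := (sum_of_copies e I).

Definition copy_gen j (a : I j) : X := dsum_inj j (dsum_inj a (right_ideal_gen j)).

Fact copy_gen_subproof j (a : I j) : copy_gen a \in corner_pred (iota j) (M := X).
Proof.
by apply/eqP; rewrite /copy_gen -!linearZ right_ideal_genE.
Qed.

Definition copy_basis j (a : I j) : corner (iota j) X :=
  exist _ (copy_gen a) (copy_gen_subproof a).

Lemma copy_basis_bij j : bijective (lincomb (@copy_basis j)).
Proof.
apply: (corner_basis_bij
  (coord := fun a => val \o (dsum_proj a \o dsum_proj j) : {linear X -> (S^c)^o})).
- exact: iota_inj.
- by move=> a; rewrite /= !dsum_projE /copy_gen !dsum_injE /= eE.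
- by move=> a a' aa'; rewrite /= !dsum_projE /copy_gen dsum_injE dsum_inj_out.
elim/dsum_ind => [|x y [c cE] [d dE]|j'].
- by exists 0; rewrite !linear0 scaler0.
- by exists (c + d); rewrite linearD corner_valD cE dE scalerDr.
elim/dsum_ind => [|x y [c cE] [d dE]|a m].
- by exists 0; rewrite !linear0 scaler0.
- by exists (c + d); rewrite linearD corner_valD cE dE linearD scalerDr.
(* The idempotent [iota j 1] kills the copies with another index. For the same index,
   [iota j 1 *: m] is sandwiched between two factors [iota j 1], so it comes from [K j]. *)
have [jj'|jj'] := eqVneq j j'; last first.
  exists 0; rewrite linear0 -!linearZ /=.
  suff -> : iota j 1 *: m = 0 by rewrite !linear0.
  by apply: val_inj; rewrite right_ideal_valZ -right_idealP mulrA iota_orth.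
subst j'.
have [c cE] := iota_surj j (val m).
exists (c *: delta (K j) a); rewrite linearZ /= lincomb_delta -!linearZ /=.
suff -> : iota j c *: right_ideal_gen j = iota j 1 *: m by [].
apply: val_inj; rewrite !right_ideal_valZ right_ideal_gen_val.
rewrite -corner_embeddingM mulr1 cE.
by rewrite -mulrA right_idealP.
Qed.

Lemma corner_copies j :
  isomorphic (dsum (fun _ : I j => (K j)^o)) (corner (iota j) X).
Proof. by exists (lincomb (@copy_basis j)); exact: copy_basis_bij. Qed.

(** An element m of the j-th corner defines a linear map from the right ideal of [e j] to [M]
    sending the generator to m. Taking for m the images of the standard basis vectors under the
    given isomorphisms yields a map that induces them on the corners. *)
Lemma isomorphic_copies (M : rSemiModType S) :
  (forall j, isomorphic (dsum (fun _ : I j => (K j)^o)) (corner (iota j) M)) ->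
  isomorphic X M.
Proof.
move=> /(_ _)/cid fP; pose f j := sval (fP j).
have fbij j : bijective (f j) := svalP (fP j).
pose g : {linear X -> M} := dsum_lift (fun j => dsum_lift (fun a : I j =>
  scale_at (val (f j (delta (K j) a))) \o val : {linear right_ideal (e j) -> M})).
exists g; apply: corner_map_bij => j.
have gE : corner_map (iota j) g \o lincomb (@copy_basis j) =1 f j.
  apply: (@free_ext _ _ _ (corner_map (iota j) g \o lincomb (@copy_basis j)) (f j)).
  move=> a; apply: val_inj; rewrite /= lincomb_delta /= /copy_gen /g !dsum_liftE /=.
  by rewrite scale_atE /= eE cornerP.
have [h hK h'K] := copy_basis_bij j.
apply: (@eq_bij _ _ (f j \o h)) => [|x]; last by rewrite /= -gE /= h'K.
by apply: bij_comp (fbij j) _; exists (lincomb (@copy_basis j)).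
Qed.

End Copies.

Section FreeCorner.
Variable I : Type.
Local Notation F := (free_semimod S I).

Fact free_gen_subproof j (p : I * 'I_(n j)) :
  (dsum_inj p.1 (v p.2 : (S^c)^o) : F) \in corner_pred (iota j) (M := F).
Proof.
apply/eqP; rewrite -linearZ.
by have -> : iota j 1 *: (v p.2 : (S^c)^o) = v p.2 by exact: vE.
Qed.

Definition free_gen j (p : I * 'I_(n j)) : corner (iota j) F :=
  exist _ (dsum_inj p.1 (v p.2 : (S^c)^o) : F) (free_gen_subproof p).

(** The basis consists of the [v k] placed in each copy of [S]; by [vu], multiplication by [u k] on
    the right in [S^c] reads off the coordinates. *)
Lemma corner_free j :
  isomorphic (dsum (fun _ : I * 'I_(n j) => (K j)^o)) (corner (iota j) F).
Proof.
exists (lincomb (@free_gen j)).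
apply: (corner_basis_bij
  (coord := fun p => scale_at (u p.2 : (S^c)^o) \o dsum_proj p.1 : {linear F -> (S^c)^o})).
- exact: iota_inj.
- move=> [a k]; rewrite /= dsum_projE dsum_injE scale_atE.
  by rewrite [LHS]vu eqxx.
- move=> [a k] [a' k'] aa'; rewrite /= dsum_projE.
  have [aE|naa'] := pselect (a = a'); last by rewrite dsum_inj_out // linear0.
  rewrite aE dsum_injE scale_atE [LHS]vu; case: eqVneq => // kk'.
  by case: aa'; rewrite aE kk'.
elim/dsum_ind => [|x y [c cE] [d dE]|a m].
- by exists 0; rewrite !linear0 scaler0.
- by exists (c + d); rewrite linearD corner_valD cE dE scalerDr.
have cP (k : 'I_(n j)) : exists c, iota j c = iota j 1 * ((m : S^c) * u k) * iota j 1.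
  exact: iota_surj.
have [c cE] := choice cP.
exists (\sum_k c k *: delta (K j) (a, k)).
rewrite linear_sum raddf_sum -linearZ.
(* Insert 1 = sum of u_k v_k on the right: the blocks with another index vanish by orthogonality,
   and in block [j] the coefficient of [v k] comes from [K j]. *)
have -> : iota j 1 *: m = \sum_k iota j (c k) *: (v k : (S^c)^o).
  rewrite -[LHS]/(iota j 1 * (m : S^c)) -[LHS]mulr1 -uv1 mulr_sumr.
  rewrite (bigD1 j) //= [X in _ + X]big1 => [|j' j'j].
    rewrite addr0 mulr_sumr; apply: eq_bigr => k _.
    by rewrite -[RHS]/(iota j (c k) * v k) cE -[RHS]mulrA vE !mulrA.
  rewrite mulr_sumr big1 // => k _.
  by rewrite -[u k]uE !mulrA -(mulrA (iota j 1)) iota_orth ?mul0r // eq_sym.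
rewrite linear_sum; apply: eq_bigr => k _.
by rewrite linearZ /= lincomb_delta /= -linearZ.
Qed.

End FreeCorner.

Lemma strongly_projective_copies (M : rSemiModType S) :
  (forall j, division_semiring (K j)) -> strongly_projective M ->
  exists I : 'I_r -> Type, isomorphic M (sum_of_copies e I).
Proof.
move=> Kdiv /strongly_projectiveP[I MF].
have basis j : exists J : Type,
    isomorphic (corner (iota j) M) (dsum (fun _ : J => (K j)^o)).
  apply: (@complemented_free _ (I * 'I_(n j))%type _ (Kdiv j)).
  apply: complemented_in_isor (isomorphic_sym (corner_free I j)) _.
  exact: corner_complemented MF.
exists (fun j => sval (cid (basis j))); apply/isomorphic_sym/isomorphic_copies => j.
exact/isomorphic_sym/(svalP (cid (basis j))).
Qed.

(** The complement 1 - e cannot be formed by subtraction. It is the sum of all the other u_k v_k,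
    once e itself is one of the terms. *)
Lemma idempotent_complement : (forall j, exists k : 'I_(n j), u k = iota j 1 /\ v k = iota j 1) ->
  forall j, exists f : S^c,
    [/\ iota j 1 + f = 1, iota j 1 * f = 0 & f * iota j 1 = 0].
Proof.
move=> k0P j; have [k0 [uk0 vk0]] := k0P j.
exists (\sum_(k | k != k0) u k * v k + \sum_(j' | j' != j) \sum_(k < n j') u k * v k).
split.
- rewrite -uv1 [RHS](bigD1 j) //= [in RHS](bigD1 k0) //= uk0 vk0 iota_idem.
  by rewrite addrA.
- rewrite mulrDr !mulr_sumr !big1 ?addr0 // => [j' j'j|k kk0].
    rewrite mulr_sumr big1 // => k _.
    by rewrite -[u k]uE !mulrA iota_orth ?mul0r // eq_sym.
  by rewrite -vk0 mulrA vu eq_sym (negPf kk0) mul0r.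
rewrite mulrDl !mulr_suml !big1 ?addr0 // => [j' j'j|k kk0].
  rewrite mulr_suml big1 // => k _.
  by rewrite -[v k]vE -!mulrA [X in _ * X]mulrA iota_orth ?mulr0.
by rewrite -uk0 -mulrA vu (negPf kk0) mulr0.
Qed.

Section CopiesProjective.
Variables (I : 'I_r -> Type).
Local Notation X := (sum_of_copies e I).
Local Notation T := {j & I j}.
Local Notation F := (free_semimod S T).

Lemma copies_strongly_projective :
  (forall j, exists k : 'I_(n j), u k = iota j 1 /\ v k = iota j 1) ->
  strongly_projective X.
Proof.
move=> /idempotent_complement/choice[f fP].
apply/strongly_projectiveP; exists T.
(* One free generator is taken for each copy. On it, [i] is the inclusion of eS in S, while [p] and
   [q] are s -> es and s -> fs, with products in S and f the complementary idempotent. *)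
pose i : {linear X -> F} := dsum_lift (fun j => dsum_lift (fun a : I j =>
  dsum_inj (existT _ j a : T) \o val : {linear right_ideal (e j) -> F})).
pose p : {linear F -> X} := dsum_lift (fun t : T =>
  dsum_inj (tag t) \o (dsum_inj (tagged t) \o scale_at (right_ideal_gen (tag t)))
  : {linear (S^c)^o -> X}).
pose q : {linear F -> F} := dsum_lift (fun t : T =>
  dsum_inj t \o scale_at (f (tag t) : (S^c)^o) : {linear (S^c)^o -> F}).
have iE j (a : I j) m :
    i (dsum_inj j (dsum_inj a m)) = dsum_inj (existT _ j a : T) (val m).
  by rewrite /i !dsum_liftE.
have pE t s : p (dsum_inj t s) =
    dsum_inj (tag t) (dsum_inj (tagged t) ((s : S^c) *: right_ideal_gen (tag t))).
  by rewrite /p dsum_liftE /= scale_atE.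
have qE t s : q (dsum_inj t s) = dsum_inj t ((s : S^c) *: (f (tag t) : (S^c)^o)).
  by rewrite /q dsum_liftE /= scale_atE.
have X_ind (P : X -> Prop) : P 0 -> (forall x y, P x -> P y -> P (x + y)) ->
    (forall j (a : I j) m, P (dsum_inj j (dsum_inj a m))) -> forall x, P x.
  move=> P0 PD Pinj; apply: dsum_ind => // j; apply: dsum_ind => //.
    by rewrite linear0.
  by move=> x y Px Py; rewrite linearD; exact: PD.
exists i, p, q; split.
- apply: X_ind => [|x y xK yK|j a m]; first by rewrite !linear0.
    by rewrite !linearD xK yK.
  rewrite iE pE /=; congr (dsum_inj j _); congr (dsum_inj a _); apply: val_inj.
  by rewrite right_ideal_valZ right_ideal_gen_val right_idealP.
- apply: dsum_ind => [|x y xE yE|t s]; first by rewrite !linear0 addr0.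
    by rewrite !linearD addrACA xE yE.
  rewrite pE qE iE; case: t => j a /=; rewrite -linearD; congr (dsum_inj _ _).
  rewrite eE; have [ef _ _] := fP j.
  by rewrite -[LHS]/((s : S^c) * iota j 1 + (s : S^c) * f j) -mulrDr ef mulr1.
- apply: X_ind => [|x y xE yE|j a m]; first by rewrite !linear0.
    by rewrite !linearD xE yE addr0.
  rewrite iE qE /=; have [_ ef _] := fP j.
  suff -> : (val m : S^c) *: (f j : (S^c)^o) = 0 by rewrite linear0.
  by rewrite -right_idealP -[LHS]/((val m : S^c) * iota j 1 * f j) -mulrA ef mulr0.
apply: dsum_ind => [|x y xE yE|t s]; first by rewrite !linear0.
  by rewrite !linearD xE yE addr0.
rewrite qE pE; have [_ _ fe] := fP (tag t).
suff -> : ((s : S^c) *: (f (tag t) : (S^c)^o) : S^c) *: right_ideal_gen (tag t) = 0.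
  by rewrite !linear0.
apply: val_inj; rewrite right_ideal_valZ right_ideal_gen_val.
by rewrite -[LHS]/((s : S^c) * f (tag t) * iota (tag t) 1) -mulrA fe mulr0.
Qed.

Lemma finitely_generated_copies (j : 'I_r) :
  finitely_generated X -> finite_set [set: I j].
Proof.
move=> [m [g gsurj]].
(* [A] collects the j-th supports of the images of the generators. Outside [A] a coordinate of [g]
   vanishes on the basis, hence everywhere, whereas [copy_gen a] has coordinate [iota j 1] at [a],
   nonzero since [iota j] is injective. *)
pose A := \bigcup_(t in [set: 'I_m]) [set a : I j | val (val (g (delta _ t)) j) a != 0].
suff AT : [set: I j] `<=` A.
  apply: sub_finite_set AT _; apply: bigcup_finite => // t _.
  by have /asboolP := valP (val (g (delta _ t)) j).
move=> a _; apply: contrapT => nAa.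
have ga : (dsum_proj a \o dsum_proj j \o g : {linear _ -> right_ideal (e j)})
    =1 (\0 : {linear _ -> right_ideal (e j)}).
  apply: free_ext => t /=; rewrite !dsum_projE; apply/eqP.
  apply: contrapT => /negP gt0; apply: nAa.
  by exists t.
have [x xE] := gsurj (copy_gen a).
have := ga x; rewrite /= xE !dsum_projE !dsum_injE => /(congr1 val).
rewrite right_ideal_gen_val => /= e0; have /eqP := oner_neq0 (K j); apply.
by apply: iota_inj; rewrite corner_embedding0.
Qed.

End CopiesProjective.

Lemma isomorphic_copies_leq (k l : 'I_r -> nat) (j : 'I_r) :
  division_semiring (K j) ->
  isomorphic (sum_of_copies e (fun j => 'I_(k j)))
             (sum_of_copies e (fun j => 'I_(l j))) ->
  (k j <= l j)%N.
Proof.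
move=> Kdiv /(corner_isomorphic (iota j)) kl.
apply: isomorphic_free_leq Kdiv _.
apply: isomorphic_trans (corner_copies (fun j => 'I_(k j)) j) _.
apply: isomorphic_trans kl _.
exact/isomorphic_sym/(corner_copies (fun j => 'I_(l j)) j).
Qed.

Lemma finitely_generated_strongly_projective (M : rSemiModType S) :
  (forall j, division_semiring (K j)) ->
  finitely_generated M -> strongly_projective M ->
  exists! k : {ffun 'I_r -> nat},
    isomorphic M (sum_of_copies e (fun j => 'I_(k j))).
Proof.
move=> Kdiv Mfg /(strongly_projective_copies Kdiv)[I MI].
have Ifin j : finite_set [set: I j].
  apply: finitely_generated_copies; have [m [g gsurj]] := Mfg.
  have [h hbij] := MI; exists m, (h \o g : {linear _ -> sum_of_copies e I}) => x.
  have [h' _ h'K] := hbij; have [y yE] := gsurj (h' x).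
  by exists y; rewrite /= yE h'K.
have /choice[k kP] j := finite_set_bij_ord (Ifin j).
pose s j := cid (kP j); pose t j := cid (svalP (s j)).
have tP j := svalP (t j).
have Mk : isomorphic M (sum_of_copies e (fun j => 'I_(finfun k j))).
  apply: isomorphic_trans MI _.
  rewrite (_ : (fun j => 'I_(finfun k j)) = (fun j => 'I_(k j))); last first.
    by apply/funext => j; rewrite ffunE.
  apply: (@sum_of_copies_reindex _ _ _ _ (fun j => 'I_(k j))
    (fun j => sval (s j)) (fun j => sval (t j))) => j.
    by have [] := tP j.
  by have [] := tP j.
exists (finfun k); split=> // l Ml; apply/ffunP => j; apply/eqP.
rewrite eqn_leq !isomorphic_copies_leq //.
  exact: isomorphic_trans (isomorphic_sym Ml) Mk.
exact: isomorphic_trans (isomorphic_sym Mk) Ml.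
Qed.

End Frame.

(** * Matrix units in a product of matrix semirings *)

Lemma division_semiring_converse (D : nzSemiRingType) :
  division_semiring D -> division_semiring D^c.
Proof.
move=> [Dmul Dinv]; split=> [x y x0 y0|x /Dinv[y y0 [xy yx]]].
  exact: Dmul y0 x0.
by exists y.
Qed.

Section FactorInj.
Variables (I : finType) (R : I -> pzSemiRingType).

Lemma factor_injE j (x : R j) : factor_inj x j = x.
Proof. exact: dfwith_in. Qed.

Lemma factor_inj_out j j' (x : R j) : j != j' -> factor_inj x j' = 0.
Proof. exact: dfwith_out. Qed.

Lemma factor_inj0 j : factor_inj (0 : R j) = 0.
Proof.
apply: functional_extensionality_dep => j'.
by have [<-|jj'] := eqVneq j j'; rewrite ?factor_injE ?factor_inj_out.
Qed.

Lemma factor_injD j (x y : R j) : factor_inj (x + y) = factor_inj x + factor_inj y.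
Proof.
apply: functional_extensionality_dep => j'.
rewrite -[RHS]/(factor_inj x j' + factor_inj y j').
by have [<-|jj'] := eqVneq j j'; rewrite ?factor_injE ?factor_inj_out ?addr0.
Qed.

Lemma factor_injMr j (x : R j) (f : semiring_prod R) :
  factor_inj x * f = factor_inj (x * f j).
Proof.
apply: functional_extensionality_dep => j'.
rewrite -[LHS]/(factor_inj x j' * f j').
by have [<-|jj'] := eqVneq j j'; rewrite ?factor_injE ?factor_inj_out ?mul0r.
Qed.

Lemma factor_injMl j (x : R j) (f : semiring_prod R) :
  f * factor_inj x = factor_inj (f j * x).
Proof.
apply: functional_extensionality_dep => j'.
rewrite -[LHS]/(f j' * factor_inj x j').
by have [<-|jj'] := eqVneq j j'; rewrite ?factor_injE ?factor_inj_out ?mulr0.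
Qed.

Lemma factor_inj_sum j (T : finType) (F : T -> R j) :
  factor_inj (\sum_t F t) = \sum_t factor_inj (F t).
Proof.
apply: (big_morph (factor_inj (R := R) (j := j)) _ (factor_inj0 j)).
exact: factor_injD.
Qed.

Lemma sum_factor_inj1 : \sum_j factor_inj (1 : R j) = 1.
Proof.
apply: functional_extensionality_dep => j.
have sumE (s : seq I) (F : I -> semiring_prod R) : (\sum_(i <- s) F i) j = \sum_(i <- s) F i j.
  by elim: s => [|i s IHs]; rewrite ?big_nil ?big_cons // -IHs.
rewrite sumE (bigD1 j) //= factor_injE big1 ?addr0 // => j' j'j.
exact: factor_inj_out.
Qed.

End FactorInj.

Section DeltaMx.
Variables (D : nzSemiRingType) (m : nat).
Implicit Types (A : 'M[D]_m) (i j : 'I_m).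

Lemma delta_mx_mulE i j A a b : (delta_mx i j *m A) a b = (a == i)%:R * A j b.
Proof.
rewrite !mxE (bigD1 j) //= !mxE eqxx andbT big1 ?addr0 // => k kj.
by rewrite !mxE (negPf kj) andbF mul0r.
Qed.

Lemma mul_delta_mxE i j A a b : (A *m delta_mx i j) a b = A a i * (b == j)%:R.
Proof.
rewrite !mxE (bigD1 i) //= !mxE eqxx big1 ?addr0 // => k ki.
by rewrite !mxE (negPf ki) mulr0.
Qed.

(** This identifies the corner cut out by e_ii in the matrix semiring with [D], through the (i, i)
    entry. *)
Lemma delta_mx_corner i A :
  delta_mx i i *m (A *m delta_mx i i) = A i i *: delta_mx i i.
Proof.
apply/matrixP => a b; rewrite delta_mx_mulE mul_delta_mxE !mxE.
by case: eqP; case: eqP; rewrite ?mul0r ?mul1r ?mulr0 ?mulr1.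
Qed.

Lemma scale_delta_mxM i (c d : D) :
  (c *: delta_mx i i) *m (d *: delta_mx i i) = (c * d) *: (delta_mx i i : 'M_m).
Proof.
apply/matrixP => a b; rewrite -scalemxAl mxE delta_mx_mulE !mxE.
by rewrite eqxx; do 2!case: eqP; rewrite /= ?mul0r ?mul1r ?mulr0 ?mulr1.
Qed.

End DeltaMx.

Section ProductFrame.
Variables (S : pzSemiRingType) (r : nat) (D : 'I_r -> nzSemiRingType).
Variables (n : 'I_r -> nat).
Variable phi : {rmorphism semiring_prod (fun j => 'M[D j]_(n j)) -> S}.
Hypothesis phi_bij : bijective phi.

Definition matrix_embed j (A : 'M[D j]_(n j)) : S :=
  phi (factor_inj (R := fun j => 'M[D j]_(n j)) A).

Lemma matrix_embed0 j : matrix_embed (0 : 'M[D j]_(n j)) = 0.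
Proof. by rewrite /matrix_embed factor_inj0 rmorph0. Qed.

Lemma matrix_embedD j (A B : 'M[D j]_(n j)) :
  matrix_embed (A + B) = matrix_embed A + matrix_embed B.
Proof. by rewrite /matrix_embed factor_injD rmorphD. Qed.

Lemma matrix_embedM j (A B : 'M[D j]_(n j)) :
  matrix_embed A * matrix_embed B = matrix_embed (A *m B).
Proof. by rewrite /matrix_embed -rmorphM factor_injMr factor_injE. Qed.

Lemma matrix_embed_inj j : injective (@matrix_embed j).
Proof.
by move=> A B /(bij_inj phi_bij)/(congr1 (@^~ j)); rewrite !factor_injE.
Qed.

Lemma matrix_embed_factor j (A B : 'M[D j]_(n j)) (x : S) : exists C : 'M[D j]_(n j),
  matrix_embed A * (x * matrix_embed B) = matrix_embed (A *m (C *m B)).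
Proof.
(* Between two elements of the j-th factor only the j-th component of the preimage of [x]
   survives. *)
have [psi _ psiK] := phi_bij; exists (psi x j).
by rewrite -[x in LHS]psiK /matrix_embed -!rmorphM factor_injMl factor_injMr factor_injE.
Qed.

Lemma matrix_embed_orth j j' (A : 'M[D j]_(n j)) (B : 'M[D j']_(n j')) (x : S) :
  j != j' -> matrix_embed A * (x * matrix_embed B) = 0.
Proof.
have [psi _ psiK] := phi_bij => jj'.
rewrite -[x]psiK /matrix_embed -!rmorphM factor_injMl factor_injMr.
by rewrite factor_inj_out 1?eq_sym // mulr0 factor_inj0 rmorph0.
Qed.

Lemma sum_matrix_embed_delta :
  \sum_j \sum_(k < n j) matrix_embed (delta_mx k k : 'M[D j]_(n j)) = 1.
Proof.
rewrite -(rmorph1 phi) -sum_factor_inj1 rmorph_sum; apply: eq_bigr => j _.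
rewrite -[RHS]/(matrix_embed (1%:M : 'M[D j]_(n j))) /matrix_embed.
rewrite -rmorph_sum -factor_inj_sum; congr (phi (factor_inj _)).
apply/matrixP => a b; rewrite summxE !mxE (bigD1 a) //= !mxE eqxx big1 ?addr0 => [|k ka].
  by rewrite eq_sym.
by rewrite !mxE eq_sym (negPf ka).
Qed.

Variable o : forall j, 'I_(n j).

(** The identification of D_j with the corner of e_11. It is set between converse semirings since
    right semimodules are left semimodules over [S^c]; both products being reversed, it stays
    multiplicative. *)
Definition scalar_embed j (d : (D j)^c) : S^c :=
  matrix_embed ((d : D j) *: delta_mx (o j) (o j)).

Fact scalar_embed0 j : @scalar_embed j 0 = 0.
Proof. by rewrite /scalar_embed scale0r matrix_embed0. Qed.

Fact scalar_embedD j : {morph @scalar_embed j : c d / c + d}.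
Proof. by move=> c d; rewrite /scalar_embed scalerDl matrix_embedD. Qed.

Fact scalar_embedM j : {morph @scalar_embed j : c d / c * d}.
Proof.
move=> c d; rewrite -[RHS]/((scalar_embed d : S) * scalar_embed c).
by rewrite /scalar_embed matrix_embedM scale_delta_mxM.
Qed.

Definition scalar_embedding j : corner_embedding (D j)^c S^c :=
  CornerEmbedding (@scalar_embed0 j) (@scalar_embedD j) (@scalar_embedM j).

Lemma scalar_embedding1 j :
  scalar_embedding j 1 = matrix_embed (delta_mx (o j) (o j)).
Proof. by rewrite /= /scalar_embed scale1r. Qed.

Lemma scalar_embedding_inj j : injective (scalar_embedding j).
Proof.
move=> c d /matrix_embed_inj/matrixP/(_ (o j) (o j)).
by rewrite !mxE !eqxx !mulr1.
Qed.

Lemma scalar_embedding_surj j (x : S^c) : exists c,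
  scalar_embedding j c = scalar_embedding j 1 * x * scalar_embedding j 1.
Proof.
have [C CE] := matrix_embed_factor (delta_mx (o j) (o j)) (delta_mx (o j) (o j)) x.
exists (C (o j) (o j)); rewrite scalar_embedding1 [RHS]CE delta_mx_corner.
by [].
Qed.

Definition unit_col j (k : 'I_(n j)) : S^c := matrix_embed (delta_mx k (o j)).
Definition unit_row j (k : 'I_(n j)) : S^c := matrix_embed (delta_mx (o j) k).

Lemma unit_colE j (k : 'I_(n j)) : scalar_embedding j 1 * unit_col k = unit_col k.
Proof.
rewrite scalar_embedding1.
by rewrite -[LHS]/((unit_col k : S) * _) matrix_embedM mul_delta_mx.
Qed.

Lemma unit_rowE j (k : 'I_(n j)) : unit_row k * scalar_embedding j 1 = unit_row k.
Proof.
rewrite scalar_embedding1.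
by rewrite -[LHS]/(_ * (unit_row k : S)) matrix_embedM mul_delta_mx.
Qed.

Lemma unit_col_row j (k k' : 'I_(n j)) :
  unit_col k * unit_row k' = if k == k' then scalar_embedding j 1 else 0.
Proof.
rewrite scalar_embedding1 -[LHS]/((unit_row k' : S) * unit_col k) matrix_embedM.
by rewrite mul_delta_mx_cond eq_sym; case: eqP => // _; rewrite mulr0n matrix_embed0.
Qed.

Lemma sum_unit_row_col : \sum_j \sum_(k < n j) unit_row k * unit_col k = 1.
Proof.
rewrite -[RHS]sum_matrix_embed_delta; apply: eq_bigr => j _; apply: eq_bigr => k _.
by rewrite -[LHS]/((unit_col k : S) * unit_row k) matrix_embedM mul_delta_mx.
Qed.

End ProductFrame.

(** * Classification through the frame of matrix units *)

Theorem theorem4p9 (S : pzSemiRingType) (r : nat)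
    (D : 'I_r -> nzSemiRingType) (n : 'I_r -> nat)
    (phi : {rmorphism semiring_prod (fun j => 'M[D j]_(n j)) -> S})
    (n_gt0 : forall j, (0 < n j)%N) :
  semisimple S ->
  (forall j, division_semiring (D j)) ->
  bijective phi ->
  let e11 (j : 'I_r) : S :=
    phi (factor_inj (R := fun j => 'M[D j]_(n j))
           (delta_mx (Ordinal (n_gt0 j)) (Ordinal (n_gt0 j)))) in
  (forall M : rSemiModType S,
     strongly_projective M <->
     exists I : 'I_r -> Type, isomorphic M (sum_of_copies e11 I)) /\
  (forall M : rSemiModType S, finitely_generated M ->
     (strongly_projective M <->
      exists! k : {ffun 'I_r -> nat},
        isomorphic M (sum_of_copies e11 (fun j => 'I_(k j))))).

Proof.
move=> _ Ddiv phi_bij e11.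
pose o j := Ordinal (n_gt0 j).
have inj := scalar_embedding_inj phi_bij (o := o).
have surj := scalar_embedding_surj phi_bij o.
have orth j j' : j != j' -> forall x : S^c,
    scalar_embedding phi o j 1 * x * scalar_embedding phi o j' 1 = 0.
  move=> jj' x; rewrite !scalar_embedding1.
  (* Products in [S^c] are reversed, so the two indices trade places. *)
  by apply: (matrix_embed_orth phi_bij (delta_mx _ _) (delta_mx _ _) x); rewrite eq_sym.
have e11E j : e11 j = scalar_embedding phi o j 1 by rewrite scalar_embedding1.
have colE := @unit_colE _ _ _ _ phi o.
have rowE := @unit_rowE _ _ _ _ phi o.
have col_row := @unit_col_row _ _ _ _ phi o.
have sum1 := sum_unit_row_col phi o.
(* The corners of a left semimodule over [S^c] are left semimodules over the converse of D_j. *)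
have Kdiv j : division_semiring (D j)^c by exact: division_semiring_converse.
have strongly_projective_of (M : rSemiModType S) (I : 'I_r -> Type) :
    isomorphic M (sum_of_copies e11 I) -> strongly_projective M.
  move=> MI; have : strongly_projective (sum_of_copies e11 I).
    apply: (copies_strongly_projective orth e11E colE rowE col_row sum1) => j.
    (* At the first index, e_1k and e_k1 are both e_11. *)
    by exists (o j); rewrite scalar_embedding1.
  move=> /strongly_projectiveP[J XJ]; apply/strongly_projectiveP; exists J.
  exact: complemented_in_isol (isomorphic_sym MI) XJ.
split=> [M|M Mfg]; split.
- exact: (strongly_projective_copies inj surj orth e11E colE rowE col_row sum1).
- by move=> [I]; exact: strongly_projective_of.
- exact: (finitely_generated_strongly_projective inj surj orth e11E colE rowE col_row sum1).
by move=> [k [Mk _]]; exact: strongly_projective_of Mk.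
Qed.
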